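(* Let $(\mathbb{A},+)$ be a finite Abelian group with $|\mathbb{A}|\ge 2$. The factor filtration $(\mathscr{F}^{\tau^{-1}},\sigma)$, on the dynamical system $(\mathbb{A}^{\mathbb{Z}},\mu,\sigma)$, is not dynamically standard.
   Context: Conventions: probability spaces are Polish spaces with their Borel $\sigma$-algebra; random variables take values in Polish spaces; $\mathcal{L}(X)$ is the law of $X$. $\Sigma(X_m:m\in I)$ denotes the $\sigma$-algebra generated by the $X_m$, $m\in I$, and the negligible sets; all $\sigma$-algebras are complete and essentially separable. A filtration is a non-decreasing sequence $\mathscr{F}=(\mathscr{F}_n)_{n\le 0}$ of sub-$\sigma$-algebras on a probability space; it is generated by $(X_n)_{n\le0}$ if $\mathscr{F}_n=\Sigma(X_m:m\le n)$ for all $n\le 0$. $\mathscr{F}$ is immersed in $\mathscr{G}$ (same space) if $\mathscr{F}_n\subset\mathscr{G}_n$ for all $n\le0$ and, for all $n\le-1$, $\mathscr{F}_{n+1}$ and $\mathscr{G}_n$ are independent conditionally to $\mathscr{F}_n$. Dynamical notions: A dynamical system $(\Omega,\mathbb{P},T)$ is a probability space with an invertible bi-measurable $\mathbb{P}$-preserving map $T$. A factor $\sigma$-algebra is a sub-$\sigma$-algebra $\mathscr{A}$ with $T^{-1}A,TA\in\mathscr{A}$ for all $A\in\mathscr{A}$. A $T$-process is a process $(Y(i))_{i\in\mathbb{Z}}$ with $Y(i)=Y(0)\circ T^i$. A factor filtration is a pair $(\mathscr{F},T)$ where $\mathscr{F}$ is a filtration on $(\Omega,\mathbb{P})$, $(\Omega,\mathbb{P},T)$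 is a dynamical system, and each $\mathscr{F}_n$ is a factor $\sigma$-algebra. $(\mathscr{F},T)$ and $(\mathscr{F}',T')$ (possibly on different dynamical systems) are dynamically isomorphic if there are processes $X=(X_n)_{n\le0}$ and $X'=(X'_n)_{n\le0}$ generating $\mathscr{F}$ and $\mathscr{F}'$ respectively, where each $X_n=(X_n(i))_{i\in\mathbb{Z}}$ is a $T$-process, each $X'_n=(X'_n(i))_{i\in\mathbb{Z}}$ is a $T'$-process, and $\mathcal{L}(X)=\mathcal{L}(X')$. $(\mathscr{F},T)$ is dynamically immersible in $(\mathscr{G},S)$ if there is a factor filtration $(\mathscr{F}',S)$, dynamically isomorphic to $(\mathscr{F},T)$, with $\mathscr{F}'$ immersed in $\mathscr{G}$. $(\mathscr{F},T)$ is dynamically of product type if there are independent factor $\sigma$-algebras $(\mathscr{G}_n)_{n\le0}$ with $\mathscr{F}_n=\bigvee_{m\le n}\mathscr{G}_m$ for all $n\le 0$. $(\mathscr{F},T)$ is dynamically standard if it is dynamically immersible in some factor filtration that is dynamically of product type. Construction of $\mathscr{F}^{\tau^{-1}}$: $\tau:\mathbb{A}^{\mathbb{Z}}\to\mathbb{A}^{\mathbb{Z}}$, $\tau x(i)=x(i)+x(i+1)$; $\mu$ is the product measure on $\mathbb{A}^{\mathbb{Z}}$ with uniform marginals (it is invariant under $\tau$ and $\sigma$); $\sigma$ is the left shift, $\sigma x(i)=x(i+1)$. On $(\mathbb{A}^{\mathbb{Z}},\mu)$ let $X_0$ be the identity map and $X_n:=\tau^{|n|}X_0$ for $n\le 0$;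 $\mathscr{F}^{\tau^{-1}}$ is the filtration generated by $(X_n)_{n\le0}$. Since $\tau$ and $\sigma$ commute, $(\mathscr{F}^{\tau^{-1}},\sigma)$ is a factor filtration. *)

(* Defs.v *)
From HB Require Import structures.
From mathcomp Require Import all_boot all_order all_algebra.
From mathcomp Require Import all_classical all_reals all_analysis.

Set Implicit Arguments.
Unset Strict Implicit.
Unset Printing Implicit Defensive.

Import Order.TTheory GRing.Theory Num.Theory.
Import numFieldNormedType.Exports.

Local Open Scope classical_set_scope.
Local Open Scope ring_scope.

(* Times n <= 0 are encoded by k = |n| : nat.  A filtration (F_n)_{n <= 0} is
   thus a sequence F with F k.+1 `<=` F k, and {m | m <= n} becomes
   [set m | (k <= m)%N]. *)

(* The measurable sets of T are the Borel sets of a Polish topology on T.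
   M carries the topology, which is transported to T along the bijection f;
   a Hausdorff pseudometric is a metric. *)
Definition polish_borel (R : realType) (d : measure_display)
    (T : measurableType d) : Prop :=
  exists (M : completePseudoMetricType R) (f : T -> M),
    [/\ hausdorff_space M,
        exists2 D : set M, countable D & dense D,
        bijective f &
        @measurable d T = preimage_set_system setT f <<s @open M >>].

Definition coordinate_sets (I : Type) (d : I -> measure_display)
    (E : forall i, measurableType (d i)) : set (set (forall i, E i)) :=
  \bigcup_i preimage_set_system setT (fun x : forall i, E i => x i) measurable.

(* For countable I and Polish factors, the product sigma-algebra is the Borel
   sigma-algebra of the product topology. *)
Definition product_space (I : Type) (d : I -> measure_display)
    (E : forall i, measurableType (d i)) :=
  g_sigma_algebraType (@coordinate_sets I d E).

Section sigma_algebras.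
Context (R : realType) (d : measure_display) (Om : measurableType d)
  (P : probability Om R).

(* The completed probability space: the Caratheodory sigma-algebra of the outer
   measure induced by P is the P-completion of the Borel sigma-algebra. *)
Definition completion := caratheodory_type (P^*)%mu.

Definition completed_prob : {measure set completion -> \bar R} :=
  @completed_measure_extension d Om R P.

Definition essentially_separable (A : set (set Om)) : Prop :=
  exists C : set (set Om),
    [/\ countable C, C `<=` A & A `<=` <<s C `|` P.-negligible >>].

Definition complete_sub_sigma_algebra (A : set (set Om)) : Prop :=
  [/\ sigma_algebra setT A,
      A `<=` (measurable : set (set completion)),
      P.-negligible `<=` A &
      essentially_separable A].

Definition Sigma (J : Type) (I : set J) (dV : J -> measure_display)
    (V : forall j, measurableType (dV j)) (X : forall j, Om -> V j) :
    set (set Om) :=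
  <<s (\bigcup_(j in I) preimage_set_system setT (X j) measurable)
      `|` P.-negligible >>.

Definition filtration (F : nat -> set (set Om)) : Prop :=
  (forall k, complete_sub_sigma_algebra (F k)) /\
  (forall k, F k.+1 `<=` F k).

Definition generated_by (F : nat -> set (set Om)) (dV : nat -> measure_display)
    (V : forall k, measurableType (dV k)) (X : forall k, Om -> V k) : Prop :=
  forall k, F k = Sigma [set m | (k <= m)%N] X.

Definition is_cond_prob (C : set (set Om)) (A : set Om) (f : Om -> R) : Prop :=
  [/\ forall B : set R, measurable B -> C (f @^-1` B),
      completed_prob.-integrable setT (EFin \o f) &
      forall c, C c ->
        (\int[completed_prob]_(x in c) (f x)%:E = completed_prob (A `&` c))%E].

(* P(a & b | C) = P(a | C) P(b | C) almost surely: the product of versions of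
   the two factors is a version of the left-hand side. *)
Definition cond_independent (A B C : set (set Om)) : Prop :=
  forall a b, A a -> B b ->
    exists f g : Om -> R,
      [/\ is_cond_prob C a f, is_cond_prob C b g &
          is_cond_prob C (a `&` b) (f \* g)].

Definition independent_family (G : nat -> set (set Om)) : Prop :=
  forall (J : seq nat) (a : nat -> set Om),
    uniq J -> (forall j, j \in J -> G j (a j)) ->
    completed_prob (\bigcap_(j in [set` J]) a j) =
    (\prod_(j <- J) completed_prob (a j))%E.

(* For n <= -1 and k.+1 = |n|, F k is F_{n+1}. *)
Definition immersed (F G : nat -> set (set Om)) : Prop :=
  (forall k, F k `<=` G k) /\
  (forall k, cond_independent (F k) (G k.+1) (F k.+1)).

End sigma_algebras.

Record automorphism (T : Type) := Automorphism {
  aut_fun :> T -> T;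
  aut_inv : T -> T;
  aut_funK : cancel aut_fun aut_inv;
  aut_invK : cancel aut_inv aut_fun
}.

Definition aut_iter (T : Type) (f : automorphism T) (i : int) : T -> T :=
  match i with
  | Posz n => iter n f
  | Negz n => iter n.+1 (aut_inv f)
  end.

Section dynamics.
Context (R : realType) (d : measure_display) (Om : measurableType d)
  (P : probability Om R) (T : automorphism Om).

Definition dynamical_system : Prop :=
  [/\ polish_borel R Om,
      measurable_fun setT T,
      measurable_fun setT (aut_inv T) &
      forall B, measurable B -> P (T @^-1` B) = P B].

Definition factor_sigma_algebra (A : set (set Om)) : Prop :=
  complete_sub_sigma_algebra P A /\
  (forall a, A a -> A (T @^-1` a) /\ A (T @` a)).

Definition factor_filtration (F : nat -> set (set Om)) : Prop :=
  [/\ dynamical_system, filtration P F &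
      forall k, factor_sigma_algebra (F k)].

Definition T_process (dE : measure_display) (E : measurableType dE)
    (Y : Om -> product_space (fun _ : int => E)) : Prop :=
  measurable_fun setT Y /\
  forall (i : int) (w : Om), Y w i = Y (aut_iter T i w) 0.

Definition dynamically_of_product_type (F : nat -> set (set Om)) : Prop :=
  exists G : nat -> set (set Om),
    [/\ forall k, factor_sigma_algebra (G k),
        independent_family P G &
        forall k, F k = <<s \bigcup_(m in [set m | (k <= m)%N]) G m >>].

End dynamics.

Section isomorphism.
Context (R : realType).

Definition same_law (d d' : measure_display)
    (Om : measurableType d) (P : probability Om R)
    (Om' : measurableType d') (P' : probability Om' R)
    (dV : nat -> measure_display) (V : forall k, measurableType (dV k))
    (X : forall k, Om -> V k) (X' : forall k, Om' -> V k) : Prop :=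
  forall B : set (product_space V), measurable B ->
    P ((fun w k => X k w) @^-1` B) = P' ((fun w k => X' k w) @^-1` B).

Definition dynamically_isomorphic (d d' : measure_display)
    (Om : measurableType d) (P : probability Om R) (T : automorphism Om)
    (F : nat -> set (set Om))
    (Om' : measurableType d') (P' : probability Om' R) (T' : automorphism Om')
    (F' : nat -> set (set Om')) : Prop :=
  exists (dE : nat -> measure_display) (E : forall k, measurableType (dE k))
    (X : forall k, Om -> product_space (fun _ : int => E k))
    (X' : forall k, Om' -> product_space (fun _ : int => E k)),
    [/\ forall k, polish_borel R (E k),
        generated_by P F X /\ generated_by P' F' X',
        forall k, T_process T (X k),
        forall k, T_process T' (X' k) &
        same_law P P' X X'].

Definition dynamically_immersible (d d' : measure_display)
    (Om : measurableType d) (P : probability Om R) (T : automorphism Om)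
    (F : nat -> set (set Om))
    (Om' : measurableType d') (P' : probability Om' R) (S : automorphism Om')
    (G : nat -> set (set Om')) : Prop :=
  exists F' : nat -> set (set Om'),
    [/\ factor_filtration P' S F',
        dynamically_isomorphic P T F P' S F' &
        immersed P' F' G].

Definition dynamically_standard (d : measure_display) (Om : measurableType d)
    (P : probability Om R) (T : automorphism Om) (F : nat -> set (set Om)) :
    Prop :=
  exists (d' : measure_display) (Om' : measurableType d')
    (P' : probability Om' R) (S : automorphism Om')
    (G : nat -> set (set Om')),
    [/\ factor_filtration P' S G,
        dynamically_of_product_type P' S G &
        dynamically_immersible P T F P' S G].

End isomorphism.

Definition letter (A : finZmodType) : Type := A.

Section letter.
Context (A : finZmodType).

HB.instance Definition _ := FinRing.Zmodule.on (letter A).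
HB.instance Definition _ := isPointed.Build (letter A) 0.
HB.instance Definition _ := @isMeasurable.Build default_measure_display
  (letter A) discrete_measurable discrete_measurable0 discrete_measurableC
  discrete_measurableU.

Definition config := product_space (fun _ : int => letter A).

Definition tau (x : config) : config := fun i => x i + x (i + 1).

Definition lshift_fun (x : config) : config := fun i => x (i + 1).
Definition lshift_inv (x : config) : config := fun i => x (i - 1).

Lemma lshift_funK : cancel lshift_fun lshift_inv.
Proof. by move=> x; apply/funext => i; rewrite /lshift_inv /lshift_fun subrK. Qed.

Lemma lshift_invK : cancel lshift_inv lshift_fun.
Proof. by move=> x; apply/funext => i; rewrite /lshift_inv /lshift_fun addrK. Qed.

Definition left_shift : automorphism config := Automorphism lshift_funK lshift_invK.

Context (R : realType).

(* These values on cylinders determine mu. *)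
Definition uniform_product_measure (mu : probability config R) : Prop :=
  forall (J : seq int) (a : int -> A), uniq J ->
    mu [set x | forall i, i \in J -> x i = a i] =
    ((#|A|%:R^-1) ^+ size J)%:E.

Definition tau_filtration (mu : probability config R) :
    nat -> set (set config) :=
  fun k => Sigma mu [set m | (k <= m)%N] (fun m => iter m tau : config -> config).

End letter.

(* Main.v *)
Require Import Defs.
From HB Require Import structures.
From mathcomp Require Import all_boot all_order all_algebra.
From mathcomp Require Import all_classical all_reals all_analysis.
From mathcomp Require Import lra zify.

(** The idea.  Let q be the number of letters and suppose that the filtration of
    tau^-1 has a copy inside a filtration G_n = \/_(m <= n) H_m with independent
    factors.  The copy carries a stationary process x of independent uniform
    letters such that tau^k x is measurable with respect to G_(-k) for each k
    ([transferred_process]).  The letter x_0 is measurable with respect to the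
    join of all the factors, so for some k it agrees with probability at least
    3/4 with a letter V_0 that depends only on the k most recent factors
    ([increasing_approximation]).  Let V_i be the image of V_0 under the i-th
    iterate of the dynamics, and Z = x - V.

    Since tau is additive, tau^k Z = tau^k x - tau^k V.  Here tau^k x is uniform
    and measurable with respect to G_(-k), while V depends on factors that are
    independent of G_(-k) ([independent_blocks]); so tau^k Z is a process of
    independent uniform letters.  A window of n letters of tau^k Z is a function
    of a window of n + k letters of Z, so each value of the latter has
    probability at most q^-n, which is q^k times its uniform probability.  This
    is the quantitative form of the fact that tau^k does not increase entropy
    and that independent uniform letters have maximal entropy: Z itself has to
    look uniform.  But Z_i = 0 has probability at least 3/4 for every i, and
    under the uniform law the proportion of zeros in a long window is close to
    1/q <= 1/2, with a quadratic deviation of order 1/n that the constant factor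
    q^k cannot compensate ([zeros_concentration], [no_approximation]).

    The transport of x to the other system reads the coordinate process as a
    function of the paths of a generating process, up to null sets; null events
    about paths are preserved by equality of laws.  It uses the invariance of
    the product measure under the shift, which follows from its values on
    cylinders. *)

Set Implicit Arguments.
Unset Strict Implicit.
Unset Printing Implicit Defensive.

Import Order.TTheory GRing.Theory Num.Theory.
Import numFieldNormedType.Exports.

Local Open Scope classical_set_scope.
Local Open Scope ring_scope.

(** * Concentration of the number of zeros in a block *)

Section concentration.
Context (R : realType) (A : finZmodType) (n : nat).
Local Notation q := (#|A|%:R : R).
Local Notation block := {ffun 'I_n -> A}.

(** Indicator of the letter 0, centred under the uniform law. *)
Let w (a : A) : R := (a == 0)%:R - q^-1.

Let q_gt0 : 0 < q.
Proof. by rewrite ltr0n; apply/card_gt0P; exists 0. Qed.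

Let sum_w : \sum_a w a = 0.
Proof.
rewrite /w big_split /= sumrN sumr_const -[X in _ - X]mulr_natr mulVf ?gt_eqF//.
rewrite (bigD1 0)//= eqxx big1 ?addr0 ?subrr// => a /negPf -> //.
Qed.

Let w_sqr_le1 a : w a ^+ 2 <= 1.
Proof.
have q1 : 1 <= q by rewrite ler1n; apply/card_gt0P; exists 0.
have qV : 0 <= q^-1 <= 1 by rewrite invr_ge0 ltW//= invf_le1.
by rewrite /w; case: (_ == _) => /=; nra.
Qed.

Lemma sum_block_prod (h : 'I_n -> A -> R) :
  \sum_(b : block) \prod_i h i (b i) = \prod_i \sum_a h i a.
Proof. by rewrite (bigA_distr_bigA h). Qed.

Let sum_ww (i j : 'I_n) :
  \sum_(b : block) w (b i) * w (b j) <= (i == j)%:R * q ^+ n.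
Proof.
case: eqVneq => [<-|ij]; last first.
  rewrite mul0r.
  (* Two distinct letters of a uniform block are independent. *)
  pose h l a : R := if l == i then w a else if l == j then w a else 1.
  under eq_bigr => b _.
    have -> : w (b i) * w (b j) = \prod_l h l (b l).
      rewrite (bigD1 i)//= (bigD1 j) ?(eq_sym j)//= big1 ?mulr1.
        by rewrite /h !eqxx (eq_sym j) (negPf ij).
      by move=> l /andP[/negPf li /negPf lj]; rewrite /h li lj.
    over.
  rewrite sum_block_prod (bigD1 i)//= {1}/h eqxx.
  by rewrite sum_w mul0r.
rewrite mul1r (le_trans (ler_sum (G := fun _ => 1) _ _))//.
  by move=> b _; rewrite -expr2 w_sqr_le1.
by rewrite sumr_const card_ffun card_ord natrX.
Qed.

(** Under the uniform law on blocks the sum S of [w] over the n letters has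
    variance at most n, so under [p] its second moment is at most C n; the mean
    of S under [p] is at least n (3/4 - 1/q) >= n / 4 since q >= 2.  The square
    of the mean being at most the second moment, n^2 / 16 <= C n. *)
Lemma zeros_concentration (p : block -> R) (C : R) :
  (2 <= #|A|)%N ->
  (forall b, 0 <= p b) -> (forall b, p b <= C * q^-1 ^+ n) ->
  \sum_b p b = 1 ->
  (forall i, 3 / 4 <= \sum_(b : block | b i == 0) p b) ->
  n%:R <= 16 * C.
Proof.
move=> q2 p0 pC p1 pz.
pose S (b : block) := \sum_i w (b i).
have ES : n%:R / 4 <= \sum_b p b * S b.
  under eq_bigr => b _ do rewrite mulr_sumr.
  rewrite exchange_big /=.
  have -> : n%:R / 4 = \sum_(i < n) (4^-1 : R).
    by rewrite sumr_const card_ord mulr_natl.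
  apply: ler_sum => i _.
  under eq_bigr => b _ do rewrite /w mulrBr.
  rewrite big_split /= sumrN -mulr_suml p1 mul1r.
  have -> : \sum_(b : block) p b * (b i == 0)%:R = \sum_(b : block | b i == 0) p b.
    rewrite [RHS]big_mkcond; apply: eq_bigr => b _.
    by case: (_ == _); rewrite ?mulr1 ?mulr0.
  have := pz i.
  have : q^-1 <= 2^-1 by rewrite lef_pV2 ?posrE// ler_nat.
  lra.
have ES2 : \sum_b p b * S b ^+ 2 <= C * n%:R.
  apply: le_trans (_ : \sum_b C * q^-1 ^+ n * S b ^+ 2 <= _).
    by apply: ler_sum => b _; rewrite ler_wpM2r ?sqr_ge0.
  rewrite -mulr_sumr.
  have C0 : 0 <= C.
    have [b _] : exists b : block, True by exists [ffun=> 0].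
    have := le_trans (p0 b) (pC b).
    by rewrite pmulr_lge0// exprn_gt0// invr_gt0.
  rewrite -mulrA ler_wpM2l//.
  under eq_bigr => b _.
    rewrite expr2 /S mulr_suml. under eq_bigr do rewrite mulr_sumr. over.
  rewrite exchange_big /=.
  under eq_bigr do rewrite exchange_big /=.
  rewrite exprVn mulrC ler_pdivrMr ?exprn_gt0//.
  apply: le_trans (ler_sum _ (fun i _ => ler_sum _ (fun j _ => sum_ww i j))) _.
  apply: le_trans (ler_sum (G := fun _ => q ^+ n) _ _) _.
    move=> i _; rewrite (bigD1 i)//= eqxx mul1r big1 ?addr0// => j.
    by rewrite eq_sym => /negPf ->; rewrite mul0r.
  by rewrite sumr_const card_ord mulr_natl.
(* Jensen's inequality, as 2 t S <= S^2 + t^2 with t the bound on the mean. *)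
pose t : R := n%:R / 4.
have AG : 2 * t * (\sum_b p b * S b) <= \sum_b p b * S b ^+ 2 + t ^+ 2.
  rewrite -[X in _ <= _ + X]mul1r -p1 mulr_suml mulr_sumr -big_split /=.
  apply: ler_sum => b _.
  have : 0 <= p b * (S b - t) ^+ 2 by rewrite mulr_ge0// sqr_ge0.
  nra.
have [->|n0] := posnP n.
  rewrite mulr_ge0//.
  have [b _] : exists b : block, True by exists [ffun=> 0].
  have := le_trans (p0 b) (pC b).
  by rewrite pmulr_lge0// exprn_gt0// invr_gt0.
have n0R : (0 : R) < n%:R by rewrite ltr0n.
have t0 : 0 < t by rewrite /t; lra.
have tn : n%:R = 4 * t by rewrite /t; lra.
rewrite tn in ES ES2 *.
nra.
Qed.

End concentration.

(** * Uniform processes and the map tau *)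

Section finite_events.
Context (W : pointedType) (S : set (set W)) (S_sigma : sigma_algebra setT S).

(** Replaces measurability with respect to a discrete sigma-algebra on a finite
    target; [S] is kept abstract because it ranges below over several
    sub-sigma-algebras of one space. *)
Lemma sigma_fin_event (I B : finType) (f : I -> W -> B)
    (Phi : {ffun I -> B} -> Prop) :
  (forall i b, S (f i @^-1` [set b])) -> S [set w | Phi [ffun i => f i w]].
Proof.
move=> mf.
have SE : @measurable _ (g_sigma_algebraType S) = S.
  exact: sigma_algebra_id.
have -> : [set w | Phi [ffun i => f i w]] =
    \bigcup_(g in Phi) \bigcap_(i in setT) f i @^-1` [set g i].
  apply/seteqP; split=> w /=.
    by move=> Pw; exists [ffun i => f i w] => // i _ /=; rewrite ffunE.
  move=> [g Pg gw]; congr Phi: (Pg); apply/ffunP => i.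
  by rewrite ffunE; have /= <- := gw i Logic.I.
rewrite -SE; apply: fin_bigcup_measurable; first exact: finite_finset.
move=> g _; apply: fin_bigcap_measurable; first exact: finite_finset.
by move=> i _; rewrite SE.
Qed.

End finite_events.

Section processes.
Context (A : finZmodType) (W : Type).
Implicit Types X Y : nat -> W -> A.

Definition adapted (S : set (set W)) X := forall i a, S (X i @^-1` [set a]).

Definition tau_process X : nat -> W -> A := fun i w => X i w + X i.+1 w.

Definition cylinder X N (b : nat -> A) : set W :=
  [set w | forall i, (i < N)%N -> X i w = b i].

End processes.
Arguments tau_process {A W}.

Section adapted_processes.
Context (A : finZmodType) (W : pointedType).
Implicit Types X Y : nat -> W -> A.

Lemma adapted_comb (op : A -> A -> A) (S : set (set W)) X Y :
  sigma_algebra setT S -> adapted S X -> adapted S Y ->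
  adapted S (fun i w => op (X i w) (Y i w)).
Proof.
move=> sS mX mY i a.
pose f (b : bool) := if b then X i else Y i.
have := @sigma_fin_event W S sS bool A f
  (fun g => op (g true) (g false) = a).
rewrite (_ : [set _ | _] = (fun w => op (X i w) (Y i w)) @^-1` [set a]).
  by apply => -[] b; [exact: mX|exact: mY].
by apply/seteqP; split=> w /=; rewrite !ffunE.
Qed.

Lemma adapted_tau (S : set (set W)) X k :
  sigma_algebra setT S -> adapted S X -> adapted S (iter k tau_process X).
Proof.
move=> sS mX; elim: k => // k IH; rewrite iterS.
apply: (adapted_comb +%R sS IH (Y := fun i => iter k tau_process X i.+1)).
by move=> i a; exact: IH.
Qed.

Lemma cylinder_sigma (S : set (set W)) X N b :
  sigma_algebra setT S -> adapted S X -> S (cylinder X N b).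
Proof.
move=> sS mX.
have := @sigma_fin_event W S sS 'I_N A (fun i => X i)
  (fun g => forall i : 'I_N, g i = b i).
rewrite (_ : [set _ | _] = cylinder X N b); first by apply=> i a; exact: mX.
apply/seteqP; split=> w /=.
  by move=> h i iN; have := h (Ordinal iN); rewrite ffunE.
by move=> h i; rewrite ffunE; exact: h.
Qed.

Lemma tau_processB X Y k i w :
  iter k tau_process (fun i w => X i w - Y i w) i w =
  iter k tau_process X i w - iter k tau_process Y i w.
Proof.
elim: k i => // k IH i; rewrite !iterS {1}/tau_process !IH /tau_process.
by rewrite opprD addrACA.
Qed.

End adapted_processes.

(** The k-th iterate at i reads only the letters of the window from i to i + k. *)
Lemma eq_tau_process (A : finZmodType) (W W' : Type)
    (X : nat -> W -> A) (Y : nat -> W' -> A) k i w w' :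
  (forall j, (i <= j <= i + k)%N -> X j w = Y j w') ->
  iter k tau_process X i w = iter k tau_process Y i w'.
Proof.
elim: k i => [|k IH] i h; first by apply: h; rewrite addn0 leqnn.
rewrite !iterS /tau_process; congr (_ + _); apply: IH => j /andP[ij jk].
  by apply: h; rewrite ij/= (leq_trans jk)// leq_add2l.
by apply: h; rewrite (ltnW ij) -addSnnS.
Qed.

Lemma tau_process_shift (A : finZmodType) (W : Type) (X : nat -> W -> A)
    (T : W -> W) k i w :
  (forall i w, X i w = X 0%N (iter i T w)) ->
  iter k tau_process X i w = iter k tau_process X 0%N (iter i T w).
Proof.
move=> XT.
have h j : iter k tau_process X (j + i) w =
    iter k tau_process X j (iter i T w).
  elim: k j => [|k IH] j; first by rewrite /= XT [RHS]XT iterD.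
  by rewrite !iterS /tau_process -!IH.
exact: h 0%N.
Qed.

Section uniform.
Context (R : realType) (A : finZmodType).
Context d (W : measurableType d) (Q : probability W R).
Local Notation q := (#|A|%:R : R).
Local Notation pr E := (fine (Q E)).
Implicit Types X Y V : nat -> W -> A.

Definition uniform_process X := forall N b, pr (cylinder X N b) = q^-1 ^+ N.

Let q_neq0 : q != 0.
Proof. by rewrite pnatr_eq0 -lt0n; apply/card_gt0P; exists 0. Qed.

Let msigma := @sigma_algebra_measurable _ W.

Lemma prE E : measurable E -> Q E = (pr E)%:E.
Proof. by move=> mE; rewrite fineK// fin_num_measure. Qed.

Lemma le_pr E F : measurable E -> measurable F -> E `<=` F -> pr E <= pr F.
Proof.
move=> mE mF EF; rewrite -lee_fin -!prE//.
by apply: le_measure; rewrite ?inE.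
Qed.

Lemma pr_ge0 E : 0 <= pr E.
Proof. by rewrite fine_ge0. Qed.

Lemma pr_partition (I : finType) (f : W -> I) E :
  measurable E -> (forall i, measurable (f @^-1` [set i])) ->
  pr E = \sum_i pr (E `&` f @^-1` [set i]).
Proof.
move=> mE mf; apply: EFin_inj; rewrite -prE// -sumEFin.
have mEf i : measurable (E `&` f @^-1` [set i]) by exact: measurableI.
under eq_bigr do rewrite -prE//.
have -> : \sum_i Q (E `&` f @^-1` [set i]) =
    (\sum_(i \in [set: I]) Q (E `&` f @^-1` [set i]))%E.
  rewrite (fsbigE (index_enum I)) ?index_enum_uniq//=.
    by apply: eq_bigl => i; symmetry; apply/mem_set.
  by move=> i _; rewrite mem_index_enum.
rewrite -measure_fin_bigcup//.
- congr (Q _); apply/seteqP; split=> [w Ew|w [i _ []//]].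
  by exists (f w).
- exact: finite_finset.
- by move=> i j _ _ [w [[_ /= <-] [_ /= <-]]].
Qed.

(** A window of [tau_process X] and the letter [X 0] determine a window of [X]
    with one more letter, through x (i + 1) = c i - x i; the q values of [X 0]
    compensate for the extra letter. *)
Lemma uniform_tau X : adapted measurable X -> uniform_process X ->
  uniform_process (tau_process X).
Proof.
move=> mX uX N c.
have mtX := adapted_tau 1 msigma mX.
rewrite (pr_partition (f := X 0%N)); [|exact: cylinder_sigma|exact: mX].
pose lift a := fix l (i : nat) : A :=
  if i is j.+1 then c j - l j else a.
have liftE a : cylinder (tau_process X) N c `&` X 0%N @^-1` [set a] =
    cylinder X N.+1 (lift a).
  apply/seteqP; split=> w /=.
    move=> [h h0]; elim=> [//|i IH] iN; rewrite /= -IH 1?ltnW//.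
    by rewrite -(h i)// /tau_process addrAC subrr add0r.
  move=> h; split; last by rewrite h.
  move=> i iN; rewrite /tau_process h 1?ltnW// (h i.+1)//=.
  by rewrite addrC subrK.
under eq_bigr do rewrite liftE uX.
by rewrite sumr_const exprS -mulrnAl -[_ *+ _]mulr_natl divff// mul1r.
Qed.

Lemma uniform_tau_iter X k : adapted measurable X -> uniform_process X ->
  uniform_process (iter k tau_process X).
Proof.
move=> mX uX; elim: k => // k IH; rewrite iterS.
by apply: uniform_tau => //; exact: adapted_tau.
Qed.

Definition cylinder_independent V Y := forall N b c,
  pr (cylinder V N b `&` cylinder Y N c) =
  pr (cylinder V N b) * pr (cylinder Y N c).

Lemma pr_blocks X N E : adapted measurable X -> measurable E ->
  pr E = \sum_(b : {ffun 'I_N -> A})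
    pr (E `&` [set w | forall i : 'I_N, X i w = b i]).
Proof.
move=> mX mE.
pose f w : {ffun 'I_N -> A} := [ffun i : 'I_N => X i w].
rewrite (pr_partition (f := f))//.
  apply: eq_bigr => b _; congr (fine (Q (_ `&` _))).
  apply/seteqP; split=> w /=; first by move=> <- i; rewrite ffunE.
  by move=> h; apply/ffunP => i; rewrite ffunE.
by move=> b; apply: (@sigma_fin_event W measurable msigma 'I_N A (fun i => X i)
  (fun g => g = b)) => i a; exact: mX.
Qed.

Definition extend_block N (b : {ffun 'I_N -> A}) (i : nat) : A :=
  if insub i is Some j then b j else 0.

Lemma extend_blockE N (b : {ffun 'I_N -> A}) (i : 'I_N) : extend_block b i = b i.
Proof. by rewrite /extend_block valK. Qed.

Lemma cylinder_extend_block X N (b : {ffun 'I_N -> A}) :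
  [set w | forall i : 'I_N, X i w = b i] = cylinder X N (extend_block b).
Proof.
apply/seteqP; split=> w /= h i.
  by move=> iN; rewrite (h (Ordinal iN)) -extend_blockE.
by rewrite -extend_blockE; exact: h.
Qed.

(** Conditionally on [V] the process [Y] keeps its law, and the uniform law is
    invariant under translation. *)
Lemma uniform_sub V Y : adapted measurable V -> adapted measurable Y ->
  uniform_process Y -> cylinder_independent V Y ->
  uniform_process (fun i w => Y i w - V i w).
Proof.
move=> mV mY uY iVY N c.
have mZ : adapted measurable (fun i w => Y i w - V i w).
  exact: (adapted_comb (fun a b => a - b)).
rewrite (@pr_blocks V N)//; last exact: cylinder_sigma.
have E (b : {ffun 'I_N -> A}) :
    cylinder (fun i w => Y i w - V i w) N c `&`
    [set w | forall i : 'I_N, V i w = b i] =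
    cylinder V N (extend_block b) `&` cylinder Y N (fun i => c i + extend_block b i).
  rewrite cylinder_extend_block; apply/seteqP; split=> w /= [h1 h2]; split=> // i iN.
    by rewrite -(h1 i)// -(h2 i)// subrK.
  by rewrite h1// h2// addrK.
under eq_bigr do rewrite E iVY uY.
rewrite -mulr_suml.
under eq_bigr do rewrite -cylinder_extend_block -[X in Q X]setTI.
by rewrite -pr_blocks// probability_setT/= mul1r.
Qed.

(** Applying the k-th iterate shortens a window by only k letters, so a process
    whose k-th iterate is uniform has window probabilities at most q ^ k times
    those of a uniform process. *)
Lemma uniform_tau_bound X k N b : adapted measurable X ->
  uniform_process (iter k tau_process X) ->
  pr (cylinder X (N + k) b) <= q^-1 ^+ N.
Proof.
move=> mX uX.
rewrite -(uX N (fun i => iter k tau_process (fun j _ => b j) i tt)).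
apply: le_pr; [exact: cylinder_sigma| |].
  by apply: cylinder_sigma => //; exact: adapted_tau.
move=> w h i iN; apply: eq_tau_process => j /andP[ij jk].
by apply: h; rewrite (leq_ltn_trans jk)// ltn_add2r.
Qed.

(** The heart of the argument.  Put Z = X - V.  Its k-th iterate is uniform, so
    the windows of Z have a density at most q ^ k with respect to the uniform
    law.  This bound does not depend on the length of the window, whereas Z
    vanishes at each time with probability at least 3/4: for long windows this
    contradicts [zeros_concentration]. *)
Lemma no_approximation X V k : (2 <= #|A|)%N ->
  adapted measurable X -> adapted measurable V -> uniform_process X ->
  cylinder_independent (iter k tau_process V)
    (iter k tau_process X) ->
  (forall i, pr [set w | X i w <> V i w] <= 4^-1) -> False.
Proof.
move=> q2 mX mV uX iVX close.
pose Z := fun i w => X i w - V i w.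
have mZ : adapted measurable Z by exact: (adapted_comb (fun a b => a - b)).
have uZ : uniform_process (iter k tau_process Z).
  have := uniform_sub (adapted_tau k msigma mV) (adapted_tau k msigma mX)
    (uniform_tau_iter k mX uX) iVX.
  move=> + N b => /(_ N b) <-; congr (fine (Q _)).
  by apply/seteqP; split=> w /= h i /h; rewrite tau_processB.
have main N : (N + k)%:R <= 16 * q ^+ k.
  apply: (@zeros_concentration R A (N + k)
    (fun b => pr (cylinder Z (N + k) (extend_block b)))) => //.
  - by move=> b; exact: pr_ge0.
  - move=> b; apply: (le_trans (uniform_tau_bound _ _ mZ uZ)).
    by rewrite exprD mulrCA -exprMn mulfV// expr1n mulr1.
  - under eq_bigr do rewrite -cylinder_extend_block -[X in Q X]setTI.
    by rewrite -pr_blocks// probability_setT.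
  - move=> i.
    have -> : \sum_(b : {ffun 'I_(N + k) -> A} | b i == 0)
        pr (cylinder Z (N + k) (extend_block b)) = pr (Z i @^-1` [set 0]).
      rewrite (@pr_blocks Z (N + k) _ mZ (mZ i 0)).
      rewrite big_mkcond; apply: eq_bigr => b _.
      rewrite cylinder_extend_block; case: eqVneq => bi.
        congr (fine (Q _)); apply/seteqP; split=> w /=; last by case.
        by move=> h; split=> //; rewrite h// extend_blockE.
      rewrite [X in Q X](_ : _ = set0) ?measure0//.
      apply/seteqP; split=> w //= [Zw h].
      by move/eqP: bi; apply; rewrite -Zw h// extend_blockE.
    have E : [set w | X i w <> V i w] = ~` (Z i @^-1` [set 0]).
      apply/seteqP; split=> w /=; apply: contra_not.
        by move=> /eqP; rewrite subr_eq0 => /eqP.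
      by move=> h; apply/eqP; rewrite subr_eq0; apply/eqP.
    have := close i; rewrite E probability_setC; last exact: mZ.
    rewrite prE; last exact: mZ.
    by rewrite -EFinB/=; lra.
have [N hN] : exists N : nat, 16 * q ^+ k < N%:R.
  exists (16 * #|A| ^ k).+1; rewrite -natrX -natrM ltr_nat//.
have := main N; rewrite leNgt => /negP; apply.
by rewrite (lt_le_trans hN)// ler_nat leq_addr.
Qed.

End uniform.

(** * Independence and approximation of joins of sigma-algebras *)

Section independence.
Context (R : realType) d (W : measurableType d) (Q : probability W R).

(** For fixed [E], the events independent of [E] form a Dynkin system. *)
Lemma independent_dynkin (E : set W) (B : set (set W)) :
  measurable E -> setI_closed B -> B `<=` measurable ->
  (forall b, B b -> Q (E `&` b) = (Q E * Q b)%E) ->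
  forall b, <<s B >> b -> Q (E `&` b) = (Q E * Q b)%E.
Proof.
move=> mE BI mB iB b sb.
suff : [set b | measurable b /\ Q (E `&` b) = (Q E * Q b)%E] b by case.
move: b sb; rewrite -setI_closed_g_dynkin_g_sigma_algebra//.
apply: smallest_sub; last by move=> b Bb; split; [exact: mB|exact: iB].
have QEf : Q E \is a fin_num by exact: fin_num_measure.
split=> /=.
- by split=> //; rewrite setIT probability_setT mule1.
- move=> b [mb Hb]; split; first exact: measurableC.
  have -> : Q (E `&` ~` b) = (Q E - Q (E `&` b))%E.
    by rewrite -setDE; apply: measureD => //; rewrite ltey_eq QEf.
  by rewrite Hb probability_setC// muleBr ?mule1.
- move=> F tF HF.
  have mF n : measurable (F n) by case: (HF n).
  have mUF : measurable (\bigcup_n F n) by exact: bigcupT_measurable.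
  have mEF n : measurable (E `&` F n) by exact: measurableI.
  split=> //; rewrite setI_bigcupr measure_semi_bigcup//=.
  + rewrite measure_semi_bigcup//= -[Q E]fineK// -nneseriesZl//.
    by apply: eq_eseriesr => n _; rewrite fineK//; case: (HF n).
  + exact: trivIset_setIl.
  + exact: bigcupT_measurable.
Qed.

Lemma independent_sigma (B C : set (set W)) :
  setI_closed B -> setI_closed C -> B `<=` measurable -> C `<=` measurable ->
  (forall b c, B b -> C c -> Q (b `&` c) = (Q b * Q c)%E) ->
  forall b c, <<s B >> b -> <<s C >> c -> Q (b `&` c) = (Q b * Q c)%E.
Proof.
move=> BI CI mB mC iBC b c sb sc.
have mc : measurable c.
  by move: c sc; apply: smallest_sub mC; exact: sigma_algebra_measurable.
rewrite setIC muleC; apply: (independent_dynkin mc BI mB _ sb) => {sb}b Bb.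
rewrite setIC muleC; apply: (independent_dynkin (mB _ Bb) CI mC _ sc) => c' Cc.
exact: iBC.
Qed.

(** A pi-system generating the join of the algebras of index in [m, n). *)
Definition rectangles (G : nat -> set (set W)) m n : set (set W) :=
  [set E | exists2 a : nat -> set W, forall j, G j (a j) &
     E = \bigcap_(j in [set j | (m <= j < n)%N]) a j].

Lemma rectanglesI (G : nat -> set (set W)) m n :
  (forall j, setI_closed (G j)) -> setI_closed (rectangles G m n).
Proof.
move=> GI _ _ [a Ga ->] [b Gb ->]; exists (fun j => a j `&` b j).
  by move=> j; exact: GI.
by rewrite bigcapI.
Qed.

Lemma rectangles_widen (G : nat -> set (set W)) m n n' :
  (forall j, G j setT) -> (n <= n')%N -> rectangles G m n `<=` rectangles G m n'.
Proof.
move=> GT nn' _ [a Ga ->]; exists (fun j => if (j < n)%N then a j else setT).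
  by move=> j; case: ifP.
apply/seteqP; split=> w /= h j /andP[mj jn].
  by case: ifPn => // jn'; apply: h => /=; rewrite mj.
by have := h j; rewrite /= mj jn (leq_trans jn nn') /=; exact.
Qed.

Lemma sub_rectangles (G : nat -> set (set W)) m n j :
  (forall j, G j setT) -> (m <= j < n)%N -> G j `<=` rectangles G m n.
Proof.
move=> GT jmn E GE; exists (fun i => if i == j then E else setT).
  by move=> i; case: eqP => [->|].
apply/seteqP; split=> w /= h; last by have := h j jmn; rewrite eqxx.
by move=> i _; case: eqP.
Qed.

(** Independence of the factors is the product rule for rectangles; it extends
    to the generated sigma-algebras, first in one argument, then in the other. *)
Lemma independent_blocks (G : nat -> set (set W)) k :
  (forall j, sigma_algebra setT (G j)) -> (forall j, G j `<=` measurable) ->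
  (forall (J : seq nat) (a : nat -> set W),
    uniq J -> (forall j, j \in J -> G j (a j)) ->
    Q (\bigcap_(j in [set` J]) a j) = (\prod_(j <- J) Q (a j))%E) ->
  forall b c,
    <<s \bigcup_(m in [set m | (m < k)%N]) G m >> b ->
    <<s \bigcup_(m in [set m | (k <= m)%N]) G m >> c ->
    Q (b `&` c) = (Q b * Q c)%E.
Proof.
move=> sG mG iG b c sb sc.
have GI j : setI_closed (G j).
  move=> E F GE GF.
  rewrite -(sigma_algebra_id (sG j)) in GE GF *.
  exact: (@measurableI _ (g_sigma_algebraType (G j))).
have GT j : G j setT.
  rewrite -(sigma_algebra_id (sG j)).
  exact: (@measurableT _ (g_sigma_algebraType (G j))).
have mrect m n : rectangles G m n `<=` measurable.
  move=> _ [a Ga ->]; apply: bigcap_measurableType => j _.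
  exact/mG/Ga.
apply: (@independent_sigma (rectangles G 0 k) (\bigcup_n rectangles G k n)).
- exact: rectanglesI.
- move=> E F [m _ Em] [n _ Fn]; exists (maxn m n) => //.
  apply: rectanglesI => //.
    by apply: rectangles_widen Em => //; exact: leq_maxl.
  by apply: rectangles_widen Fn => //; exact: leq_maxr.
- exact: mrect.
- by move=> E [n _]; exact: mrect.
- move=> _ _ [a Ga ->] [n _ /(rectangles_widen GT (leq_addl k n))[a' Ga' ->]].
  (* Both rectangles are read off one sequence of events. *)
  pose u j := if (j < k)%N then a j else a' j.
  have Gu j : G j (u j) by rewrite /u; case: ifP.
  pose H m n := \bigcap_(j in [set` iota m n]) u j.
  have -> : \bigcap_(j in [set j | (0 <= j < k)%N]) a j = H 0 k.
    apply/seteqP; split=> w /= h j.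
      rewrite /= mem_iota add0n => /= jk.
      by rewrite /u jk; exact: h.
    by move=> /= jk; have := h j; rewrite /= mem_iota add0n jk /u jk; exact.
  have -> : \bigcap_(j in [set j | (k <= j < k + n)%N]) a' j = H k n.
    apply/seteqP; split=> w /= h j.
      rewrite /= mem_iota => /andP[kj jn].
      by rewrite /u ltnNge kj; apply: h; rewrite /= kj.
    move=> /= /andP[kj jn]; have := h j.
    by rewrite /= mem_iota kj jn /u ltnNge kj; exact.
  have -> : H 0 k `&` H k n = H 0 (k + n).
    rewrite /H iotaD add0n; apply/seteqP; split=> w /=.
      by move=> [h1 h2] j /=; rewrite mem_cat => /orP[]; [exact: h1|exact: h2].
    by move=> h; split=> j /= jI; apply: h; rewrite /= mem_cat jI ?orbT.
  rewrite /H !iG ?iota_uniq// iotaD big_cat//=.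
- move: b sb; apply: smallest_sub; first exact: smallest_sigma_algebra.
  move=> E [m /= mk GE].
  by apply: sub_sigma_algebra; apply: (sub_rectangles _ (j := m)) GE.
- move: c sc; apply: smallest_sub; first exact: smallest_sigma_algebra.
  move=> E [m /= km GE]; apply: sub_sigma_algebra; exists m.+1 => //.
  by apply: (sub_rectangles _ (j := m)) GE => //; rewrite km /=.
Qed.

End independence.

Section approximation.
Context (R : realType) d (W : measurableType d) (Q : probability W R).
Local Notation pr E := (fine (Q E)).

Lemma pr_subU E F H : measurable E -> measurable F -> measurable H ->
  H `<=` E `|` F -> pr H <= pr E + pr F.
Proof.
move=> mE mF mH HEF.
apply: le_trans (le_pr Q mH (measurableU _ _ mE mF) HEF) _.
rewrite -lee_fin EFinD -!prE//; last exact: measurableU.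
exact: measureU2.
Qed.

(** The events that can be approximated form a sigma-algebra: they are stable
    under complement and finite union, and under increasing union because the
    measure is continuous from below. *)
Lemma increasing_approximation (G : nat -> set (set W)) (E : set W) :
  (forall k, sigma_algebra setT (G k)) -> (forall k, G k `<=` measurable) ->
  (forall j k, (j <= k)%N -> G j `<=` G k) ->
  <<s \bigcup_k G k >> E ->
  forall e : R, 0 < e -> exists k F, G k F /\ pr (E `+` F) <= e.
Proof.
move=> sG mG homoG sE.
have mY E' F' : measurable E' -> measurable F' ->
    measurable (E' `+` F' : set W).
  by move=> mE mF; apply: measurableU; exact: measurableD.
pose App E := measurable E /\ forall e : R, 0 < e ->
  exists k F, G k F /\ pr (E `+` F) <= e.
suff : App E by case.
have AppC E' : App E' -> App (~` E').
  move=> [mE aE]; split; first exact: measurableC.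
  move=> e /aE[k [F [GF h]]]; exists k, (~` F); split.
    by have [_ + _] := sG k => /(_ _ GF); rewrite setTD.
  suff -> : ~` E' `+` ~` F = E' `+` F by [].
  apply/seteqP; split=> w /=.
    by move=> [[h1 /contrapT h2]|[h1 /contrapT h2]]; [right|left].
  by move=> [[h1 h2]|[h1 h2]]; [right|left]; split=> //; apply/not_notP.
have AppU E' F' : App E' -> App F' -> App (E' `|` F').
  move=> [mE aE] [mF aF]; split; first exact: measurableU.
  move=> e e0; have e2 : 0 < e / 2 by lra.
  have [k1 [E1 [GE1 h1]]] := aE _ e2.
  have [k2 [E2 [GE2 h2]]] := aF _ e2.
  have GE1' := homoG _ _ (leq_maxl k1 k2) _ GE1.
  have GE2' := homoG _ _ (leq_maxr k1 k2) _ GE2.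
  exists (maxn k1 k2), (E1 `|` E2); split.
    rewrite -(sigma_algebra_id (sG _)) in GE1' GE2' *.
    exact: (@measurableU _ (g_sigma_algebraType (G (maxn k1 k2)))).
  have mE1 := mG _ _ GE1; have mE2 := mG _ _ GE2.
  apply: le_trans (_ : pr (E' `+` E1) + pr (F' `+` E2) <= _); last lra.
  apply: pr_subU; do ?exact: mY.
    by apply: mY; exact: measurableU.
  move=> w /=; rewrite /setY /=.
  by case=> [[[h|h]]|[[h|h]]] /not_orP[h3 h4]; [left;left|right;left|left;right|right;right].
have App0 : App set0.
  split => // e e0; exists 0%N, set0; split; first by case: (sG 0%N).
  by rewrite setYK measure0 /= ltW.
have Appndseq F : nondecreasing_seq F -> (forall n, App (F n)) ->
    App (\bigcup_n F n).
  move=> ndF aF.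
  have mF n : measurable (F n) by case: (aF n).
  have mUF : measurable (\bigcup_n F n) by exact: bigcupT_measurable.
  split=> // e e0; have e2 : 0 < e / 2 by lra.
  have [n hn] : exists n, pr (\bigcup_n F n) - pr (F n) < e / 2.
    have cvgF : Q (F n) @[n --> \oo] --> (pr (\bigcup_n F n))%:E.
      by rewrite -prE//; exact: nondecreasing_cvg_mu.
    have cvgf : pr (F n) @[n --> \oo] --> pr (\bigcup_n F n).
      exact: fine_cvg cvgF.
    move/cvgrPdist_lt: cvgf => /(_ _ e2)[N _ hN].
    exists N; apply: le_lt_trans (hN N (leqnn _)) => /=; exact: ler_norm.
  have [_ /(_ _ e2)[k [H [GH hH]]]] := aF n.
  exists k, H; split=> //.
  have mH := mG _ _ GH.
  apply: le_trans (_ : pr (\bigcup_n F n `\` F n) + pr (F n `+` H) <= _).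
    apply: pr_subU; [exact: measurableD|exact: mY|exact: mY|].
    move=> w /= [[[i _ Fi] nH]|[Hw nF]].
      have [Fn|nFn] := pselect (F n w); first by right; left.
      by left; split=> //; exists i.
    by right; right; split=> // Fn; apply: nF; exists n.
  have -> : pr (\bigcup_n F n `\` F n) = pr (\bigcup_n F n) - pr (F n).
    rewrite measureD//; last by rewrite ltey_eq fin_num_measure.
    rewrite setIidr; last exact: bigcup_sup.
    by rewrite fineB ?fin_num_measure.
  lra.
move: E sE; apply: smallest_sub; last first.
  move=> E [k _ GE]; split; first exact: mG GE.
  by move=> e e0; exists k, E; rewrite setYK measure0 ltW.
split=> //; first by move=> E aE; rewrite setTD; exact: AppC.
move=> F aF.
have -> : \bigcup_n F n = \bigcup_n \big[setU/set0]_(i < n.+1) F i.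
  by rewrite bigcup_bigsetU_bigcup.
apply: Appndseq.
  by move=> n m nm; apply/subsetPset; exact: subset_bigsetU.
elim=> [|n IH]; first by rewrite big_ord1.
by rewrite big_ord_recr; exact: AppU.
Qed.

End approximation.

Lemma pr_union (R : realType) d (W : measurableType d) (Q : probability W R)
    (I : finType) (F : I -> set W) E :
  (forall i, measurable (F i)) -> measurable E -> E `<=` \bigcup_i F i ->
  fine (Q E) <= \sum_i fine (Q (F i)).
Proof.
move=> mF mE EF.
have mU (s : seq I) : measurable (\bigcup_(i in [set` s]) F i).
  by apply: fin_bigcup_measurable; first exact: finite_seq.
have h (s : seq I) :
    fine (Q (\bigcup_(i in [set` s]) F i)) <= \sum_(i <- s) fine (Q (F i)).
  elim: s => [|i s IH].
    by rewrite big_nil set_nil bigcup_set0 measure0.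
  rewrite big_cons; apply: le_trans (_ : _ + fine (Q (\bigcup_(i in [set` s]) F i)) <= _).
    apply: (pr_subU _ (mF i) (mU s)); first exact: mU.
    move=> w [j]; rewrite /= inE => /orP[/eqP ->|js Fj]; first by left.
    by right; exists j.
  by rewrite lerD2l.
apply: le_trans (h (index_enum I)).
apply: le_pr => // w /EF[i _ Fi]; exists i => //=.
exact: mem_index_enum.
Qed.

(** * Null sets, preimages and transfer along an equality of laws *)

Section letters.
Context (A : finZmodType) (W : pointedType).

(** Decodes a letter from a family of events, one for each letter; the events
    need not form a partition, hence the default value 0. *)
Definition letter_of (D : A -> set W) (w : W) : A :=
  odflt 0 [pick a | `[< D a w >]].

Lemma letter_of_sigma (S : set (set W)) (D : A -> set W) a :
  sigma_algebra setT S -> (forall a, S (D a)) -> S (letter_of D @^-1` [set a]).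
Proof.
move=> sS SD.
have := @sigma_fin_event W S sS A bool (fun a w => `[< D a w >])
  (fun g => odflt 0 [pick a | g a] = a).
rewrite (_ : [set _ | _] = letter_of D @^-1` [set a]).
  apply=> b [].
    rewrite (_ : _ @^-1` _ = D b)//.
    by apply/seteqP; split=> w /=; [exact: asboolW|exact: asboolT].
  rewrite (_ : _ @^-1` _ = setT `\` D b); first by case: sS => _ + _; exact.
  by apply/seteqP; split=> w /=; [move/asboolP|move=> [_ h]; apply/asboolP].
apply/funext => w /=; congr (odflt 0 _ = a).
by apply: eq_pick => b; rewrite ffunE.
Qed.

Lemma letter_of_eq (D : A -> set W) w a :
  (forall b, D b w <-> a = b) -> letter_of D w = a.
Proof.
move=> h; rewrite /letter_of; case: pickP => [b /asboolP /h//|/(_ a)/asboolP].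
by case; apply/h.
Qed.

End letters.

Section measure_tools.
Context (R : realType).

Lemma negligible_fin d (W : measurableType d) (P : probability W R)
    (I : finType) (F : I -> set W) :
  (forall i, P.-negligible (F i)) -> P.-negligible (\bigcup_i F i).
Proof.
move=> nF.
have h (s : seq I) : P.-negligible [set w | exists2 i, i \in s & F i w].
  elim: s => [|i s IH].
    by apply: negligibleS (negligible_set0 P) => w [].
  apply: negligibleS (negligibleU (nF i) IH) => w [j].
  by rewrite inE => /orP[/eqP ->|js Fj]; [left|right; exists j].
apply: negligibleS (h (enum I)) => w [i _ Fi].
by exists i => //; rewrite mem_enum.
Qed.

Lemma pr_ae_eq d (W : measurableType d) (P : probability W R) E F :
  measurable E -> measurable F -> P.-negligible (E `+` F) -> P E = P F.
Proof.
have h E' F' : measurable E' -> measurable F' -> P.-negligible (E' `+` F') ->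
    (P E' <= P F')%E.
  move=> mE mF nEF.
  have nD : P.-negligible (E' `\` F').
    by apply: negligibleS nEF => w; left.
  have mD : measurable (E' `\` F') by exact: measurableD.
  rewrite -[leRHS]adde0 -(measure_negligible mD nD).
  apply: le_trans (measureU2 _ mF mD).
  apply: le_measure; rewrite ?inE//; first exact: measurableU.
  by move=> w Ew; have [|] := pselect (F' w); [left|right].
move=> mE mF nEF; apply/eqP; rewrite eq_le !h//.
by rewrite setYC.
Qed.

Lemma negligible_preimage d (W : measurableType d) (P : probability W R)
    (T : W -> W) N :
  measurable_fun setT T -> (forall B, measurable B -> P (T @^-1` B) = P B) ->
  P.-negligible N -> P.-negligible (T @^-1` N).
Proof.
move=> mT PT [B [mB PB NB]]; exists (T @^-1` B); split.
- by rewrite -[X in measurable X]setTI; exact: mT.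
- by rewrite PT.
- by move=> w /NB.
Qed.

(** Preimages of a cover form a cover of the preimage, with the same total mass. *)
Lemma mu_ext_preimage d (W : measurableType d) (P : probability W R)
    (T : W -> W) E :
  measurable_fun setT T -> (forall B, measurable B -> P (T @^-1` B) = P B) ->
  (P^*%mu (T @^-1` E) <= P^*%mu E)%E.
Proof.
move=> mT PT; apply: le_ereal_inf_tmp => _ [B [mB EB] <-].
apply: ereal_inf_lbound; exists (fun n => T @^-1` B n); first split.
- by move=> n; rewrite -[X in measurable X]setTI; exact: mT.
- by move=> w /EB[n _ Bn]; exists n.
- by apply: eq_eseriesr => n _; rewrite PT.
Qed.

Lemma sigma_preimage (W W' : Type) (f : W -> W') (B : set (set W'))
    (S : set (set W)) :
  sigma_algebra setT S -> (forall b, B b -> S (f @^-1` b)) ->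
  forall b, <<s B >> b -> S (f @^-1` b).
Proof.
move=> [S0 SC SU] SB; apply: smallest_sub; last exact: SB.
split=> /=.
- by rewrite preimage_set0.
- by move=> b Sb; rewrite setTD preimage_setC -setTD; exact: SC.
- by move=> F SF; rewrite preimage_bigcup; exact: SU.
Qed.

Lemma sigma_ae_eq d (W : measurableType d) (P : probability W R)
    (S : set (set W)) E F :
  sigma_algebra setT S -> P.-negligible `<=` S ->
  S E -> P.-negligible (E `+` F) -> S F.
Proof.
move=> sS nS SE nEF.
have S1 : S (E `\` F) by apply: nS; apply: negligibleS nEF => w; left.
have S2 : S (F `\` E) by apply: nS; apply: negligibleS nEF => w; right.
have -> : F = (E `\` (E `\` F)) `|` (F `\` E).
  apply/seteqP; split=> w /=.
    move=> Fw; have [Ew|] := pselect (E w); last by right.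
    by left; split=> // -[].
  by move=> [[Ew nE]|[]//]; apply: contrapT => nF; exact: nE.
rewrite -(sigma_algebra_id sS) in SE S1 S2 *.
apply: (@measurableU _ (g_sigma_algebraType S)) => //.
exact: (@measurableD _ (g_sigma_algebraType S)).
Qed.

End measure_tools.

Section product_spaces.

Lemma coordinate_measurable (I : Type) (d : I -> measure_display)
    (E : forall i, measurableType (d i)) i :
  measurable_fun setT (fun x : product_space E => x i).
Proof.
move=> _ B mB; rewrite setTI; apply: sub_sigma_algebra; exists i => //.
by exists B => //; rewrite setTI.
Qed.

Lemma product_measurable d (W : measurableType d) (I : Type)
    (dE : I -> measure_display) (E : forall i, measurableType (dE i))
    (f : W -> product_space E) :
  (forall i, measurable_fun setT (fun w => f w i)) -> measurable_fun setT f.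
Proof.
move=> mf; apply: measurability; first by [].
move=> _ [_ [i _ [B mB <-]] <-].
by rewrite setTI setTI; have := mf i measurableT B mB; rewrite setTI.
Qed.

End product_spaces.

Section transfer.
Context (R : realType).
Context d (Om : measurableType d) (P : probability Om R).
Context d' (Om' : measurableType d') (P' : probability Om' R).
Context (dV : nat -> measure_display) (V : forall k, measurableType (dV k)).
Context (X : forall k, Om -> V k) (X' : forall k, Om' -> V k).
Hypothesis mX : forall k, measurable_fun setT (X k).
Hypothesis mX' : forall k, measurable_fun setT (X' k).
Hypothesis law : same_law P P' X X'.

Definition joint d0 (W : measurableType d0) (Y : forall k, W -> V k) (w : W) :
  product_space V := fun k => Y k w.

Lemma joint_measurable d0 (W : measurableType d0) (Y : forall k, W -> V k) B :
  (forall k, measurable_fun setT (Y k)) -> measurable B ->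
  measurable (joint Y @^-1` B).
Proof.
move=> mY mB.
have := product_measurable (f := joint Y) mY measurableT mB.
by rewrite setTI.
Qed.

Lemma transfer_negligible B : measurable B ->
  P.-negligible (joint X @^-1` B) -> P'.-negligible (joint X' @^-1` B).
Proof.
move=> mB nB; apply/negligibleP; first exact: joint_measurable.
rewrite -(measure_negligible (joint_measurable mX mB) nB).
by symmetry; exact: law.
Qed.

(** Up to null sets, an event of the sigma-algebra generated by a process is an
    event about the paths of the process, and the same event about the paths
    can be read on any other process; the sigma-algebra [Sigma P' I X'] records
    that only the coordinates in [I] are involved. *)
Lemma transfer_Sigma I E : Sigma P I X E -> exists B : set (product_space V),
  [/\ measurable B, P.-negligible (E `+` joint X @^-1` B) &
      Sigma P' I X' (joint X' @^-1` B)].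
Proof.
move: E; apply: smallest_sub.
- split=> /=.
  + exists set0 => //; split=> //; first by rewrite setYK; exact: negligible_set0.
    exact: sigma_algebra0.
  + move=> E [B [mB nB sB]]; exists (~` B).
    split; [exact: measurableC| |]; last by rewrite preimage_setC; exact: sigma_algebraC.
    apply: negligibleS nB => w /=.
    case=> [[[_ h1] /contrapT h2]|[h1 /not_andP[]//]]; first by right.
    by move=> /contrapT h2; left.
  + move=> E /choice[B hB].
    exists (\bigcup_n B n); split.
    + by apply: bigcupT_measurable => n; case: (hB n).
    + apply: negligibleS (negligible_bigcup
          (F := fun n => E n `+` joint X @^-1` B n) _).
        move=> w /= [[[n _ En] h]|[[n _ Bn] h]]; exists n => //.
          by left; split=> // Bn; apply: h; exists n.
        by right; split=> // En; apply: h; exists n.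
      by move=> n; case: (hB n).
    + rewrite preimage_bigcup; apply: sigma_algebra_bigcup => n.
      by case: (hB n).
- move=> E [[j Ij [B mB <-]]|nE].
    exists ((fun y : product_space V => y j) @^-1` B); rewrite setTI; split.
    + by rewrite -[X in measurable X]setTI; exact: coordinate_measurable.
    + by rewrite setYK; exact: negligible_set0.
    + apply: sub_sigma_algebra; left; exists j => //; exists B => //.
      by rewrite setTI.
  exists set0; rewrite !preimage_set0 setY0; split=> //.
  exact: sigma_algebra0.
Qed.

End transfer.

(** * The uniform product measure *)

Lemma coord_measurable (A : finZmodType) (i : int) (B : set A) :
  measurable [set x : config A | B (x i)].
Proof.
have := @coordinate_measurable int (fun _ => default_measure_display)
  (fun _ => letter A) i measurableT B I.
by rewrite setTI.
Qed.

Section uniform_product_measure.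
Context (R : realType) (A : finZmodType) (mu : probability (config A) R).
Hypothesis hmu : uniform_product_measure mu.
Local Notation q := (#|A|%:R : R).

Let cyl (J : seq int) (a : int -> A) : set (config A) :=
  [set x | forall i, i \in J -> x i = a i].

Let cyl_measurable J a : measurable (cyl J a).
Proof.
rewrite (_ : cyl J a = \bigcap_(i in [set` J]) [set x | x i = a i])//.
apply: fin_bigcap_measurable; first exact: finite_seq.
by move=> i _; exact: (coord_measurable i [set a i]).
Qed.

Lemma left_shift_measurable : measurable_fun setT (left_shift A).
Proof.
apply: product_measurable => i _ B mB; rewrite setTI.
exact: (coord_measurable (i + 1) B).
Qed.

(** The shift permutes the cylinders and preserves their measure; the cylinders,
    together with the empty set, form a pi-system generating the sigma-algebra. *)
Lemma left_shift_preserves B : measurable B -> mu (left_shift A @^-1` B) = mu B.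
Proof.
move=> mB.
pose C : set (set (config A)) :=
  [set E | E = set0 \/ exists J a, uniq J /\ E = cyl J a].
have CI : setI_closed C.
  move=> E F [->|[J [a [uJ ->]]]]; first by left; rewrite set0I.
  move=> [->|[J' [a' [uJ' ->]]]]; first by left; rewrite setI0.
  have [->|/set0P[x [xa xa']]] := eqVneq (cyl J a `&` cyl J' a') set0.
    by left.
  (* Two cylinders with a common point x are both prescribed by x. *)
  right; exists (undup (J ++ J')), x; rewrite undup_uniq; split=> //.
  apply/seteqP; split=> y /= => [[ya ya'] i|h].
    rewrite mem_undup mem_cat => /orP[iJ|iJ']; first by rewrite ya// xa.
    by rewrite ya'// xa'.
  by split=> i iJ; rewrite h ?mem_undup ?mem_cat ?iJ ?orbT//; [exact: xa|exact: xa'].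
have genC : @measurable _ (config A) = <<s C >>.
  apply/seteqP; split.
    apply: smallest_sub; first exact: smallest_sigma_algebra.
    move=> _ [i _ [D _ <-]]; rewrite setTI.
    have -> : (fun x : config A => x i) @^-1` D =
        \bigcup_(a in (D : set A)) cyl [:: i] (fun=> a).
      apply/seteqP; split=> x /=.
        by move=> Dx; exists (x i) => // j; rewrite inE => /eqP ->.
      by move=> [a Da /(_ i)]; rewrite inE eqxx => ->.
    apply: (@fin_bigcup_measurable _ (g_sigma_algebraType C)).
      exact: finite_finset.
    by move=> a _; apply: sub_sigma_algebra; right; exists [:: i], (fun=> a).
  apply: smallest_sub; first exact: sigma_algebra_measurable.
  by move=> E [->|[J [a [_ ->]]]]; [exact: measurable0|exact: cyl_measurable].
have mT D : measurable D -> measurable (left_shift A @^-1` D).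
  by move=> mD; rewrite -[X in measurable X]setTI; exact: left_shift_measurable.
rewrite genC in mB; move: B mB.
apply: (dynkin_induction (P := fun B => mu (left_shift A @^-1` B) = mu B)) => //.
- move=> E [->|[J [a [uJ ->]]]]; first by rewrite preimage_set0.
  have uJ1 : uniq [seq i + 1 | i <- J].
    by rewrite map_inj_uniq//; exact: addIr.
  have -> : left_shift A @^-1` cyl J a =
      cyl [seq i + 1 | i <- J] (fun i => a (i - 1)).
    apply/seteqP; split=> x /= h i.
      by move=> /mapP[j jJ ->]; rewrite addrK; exact: h.
    move=> iJ; have := h (i + 1); rewrite addrK; apply.
    exact: (map_f (fun i => i + 1)).
  by rewrite (hmu _ uJ1) (hmu _ uJ) size_map.
- move=> E mE hE; rewrite preimage_setC !probability_setC// ?hE//.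
  exact: mT.
- move=> F mF tF hF; rewrite preimage_bigcup.
  have mTF n : measurable (left_shift A @^-1` F n) by exact: mT.
  have mUTF : measurable (\bigcup_n (left_shift A @^-1` F n)).
    exact: bigcupT_measurable.
  have mUF : measurable (\bigcup_n F n) by exact: bigcupT_measurable.
  have tTF : trivIset setT (fun n => left_shift A @^-1` F n).
    by move=> m n _ _ [w [Fm Fn]]; apply: tF => //; exists (left_shift A w).
  by rewrite !measure_semi_bigcup//=; apply: eq_eseriesr => n _; exact: hF.
Qed.

Lemma uniform_cylinder N (b : nat -> A) :
  mu [set x : config A | forall i : nat, (i < N)%N -> x i = b i] =
  (q^-1 ^+ N)%:E.
Proof.
pose J := [seq Posz i | i <- iota 0 N].
have uJ : uniq J by rewrite map_inj_uniq ?iota_uniq// => i j [].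
have := hmu (fun i => b `|i|%N) uJ.
rewrite size_map size_iota => <-; congr (mu _); apply/seteqP; split=> x /= h.
  by move=> _ /mapP[i + ->]; rewrite mem_iota => /h.
move=> i iN; apply: (h i); apply/mapP; exists i => //.
by rewrite mem_iota.
Qed.

End uniform_product_measure.

(** * The copy of the coordinate process *)

Section completed.
Context (R : realType) d (W : measurableType d) (P : probability W R).

(** The factors contain null sets that need not be Borel, so the argument takes
    place on the completed space. *)
Definition completed_probability : set (completion P) -> \bar R :=
  completed_prob P.

Lemma completed_probabilityE (B : set W) : measurable B -> completed_probability B = P B.
Proof. by move=> mB; exact: (measurable_mu_extE P mB). Qed.

Let completed_setT : completed_probability setT = 1%E.
Proof. by rewrite completed_probabilityE// probability_setT. Qed.

HB.instance Definition _ := Measure.on completed_probability.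
HB.instance Definition _ := Measure_isProbability.Build _ _ _
  completed_probability completed_setT.

Lemma measurable_completion (B : set W) :
  measurable B -> measurable (B : set (completion P)).
Proof. exact: caratheodory_measurable_mu_ext. Qed.

End completed.
Arguments completed_probability {R d W} P _.
Arguments completed_probabilityE {R d W} P [B] _.

Section shifted_processes.
Context d (Om : measurableType d) (T : automorphism Om).
Context dE (E : measurableType dE).

Definition shift_sequence (y : product_space (fun _ : int => E)) :
  product_space (fun _ : int => E) := fun j => y (j + 1).

Lemma shift_sequence_measurable : measurable_fun setT shift_sequence.
Proof.
by apply: product_measurable => j; exact: coordinate_measurable.
Qed.

Lemma aut_iterS (i : int) w : aut_iter T i (T w) = aut_iter T (i + 1) w.
Proof.
case: i => [n|[|n]].
- by rewrite (_ : Posz n + 1 = Posz n.+1); [rewrite /aut_iter iterSr|lia].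
- by rewrite /= aut_funK.
- rewrite (_ : Negz n.+1 + 1 = Negz n); last lia.
  by rewrite /aut_iter iterSr aut_funK.
Qed.

Lemma T_process_shift (Y : Om -> product_space (fun _ : int => E)) w :
  T_process T Y -> Y (T w) = shift_sequence (Y w).
Proof.
move=> [_ hY]; apply: functional_extensionality_dep => j.
by rewrite /shift_sequence hY aut_iterS -hY.
Qed.

End shifted_processes.

Section copy.
Context (R : realType) (A : finZmodType).
Context (mu : probability (config A) R) (hmu : uniform_product_measure mu).
Context d' (Om : measurableType d') (P : probability Om R) (S : automorphism Om).
Context (dE : nat -> measure_display) (E : forall k, measurableType (dE k)).
Context (X : forall k, config A -> product_space (fun _ : int => E k))
  (X' : forall k, Om -> product_space (fun _ : int => E k)).
Hypothesis SX : forall k, T_process (left_shift A) (X k).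
Hypothesis SX' : forall k, T_process S (X' k).
Hypothesis law : same_law mu P X X'.
Hypothesis gen : generated_by mu (tau_filtration mu) X.
Local Notation q := (#|A|%:R : R).

Let path_space := product_space (fun k => product_space (fun _ : int => E k)).

Let mX k : measurable_fun setT (X k). Proof. by case: (SX k). Qed.
Let mX' k : measurable_fun setT (X' k). Proof. by case: (SX' k). Qed.

(** The dynamics seen on paths: by [joint_shift] and [joint_shift'] it represents
    both automorphisms. *)
Definition shift_path (y : path_space) : path_space :=
  fun k => shift_sequence (y k).

Lemma shift_path_measurable : measurable_fun setT shift_path.
Proof.
apply: product_measurable => k.
apply: (measurableT_comp (@shift_sequence_measurable _ (E k))).
exact: coordinate_measurable.
Qed.

Lemma joint_shift i x :
  joint X (iter i (left_shift A) x) = iter i shift_path (joint X x).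
Proof.
elim: i => // i IH; rewrite !iterS -IH; apply: functional_extensionality_dep => k.
exact: T_process_shift.
Qed.

Lemma joint_shift' i w :
  joint X' (iter i S w) = iter i shift_path (joint X' w).
Proof.
elim: i => // i IH; rewrite !iterS -IH; apply: functional_extensionality_dep => k.
exact: T_process_shift.
Qed.

(** Up to null sets the coordinate at 0 is a function [phi 0] of the generating
    process [X], and by invariance of [mu] the coordinate at i is [phi 0]
    composed with the i-th shift of the paths.  Evaluating the same functions
    on the paths of [X'] gives a process with the same law, for which the k-th
    iterate of [tau_process] is again determined by the coordinates of [X'] of
    index at least k. *)
Lemma transferred_process : exists x : nat -> Om -> A,
  [/\ forall i w, x i w = x 0%N (iter i S w),
      adapted measurable x,
      forall N b, P (cylinder x N b) = (q^-1 ^+ N)%:E &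
      forall k c, exists2 B : set Om, Sigma P [set m | (k <= m)%N] X' B &
        P.-negligible (B `+` iter k tau_process x 0%N @^-1` [set c])].
Proof.
have sym k (c : A) : tau_filtration mu k
    [set x | (iter k (@tau A) x : config A) 0 = c].
  apply: sub_sigma_algebra; left; exists k => /=; first exact: leqnn.
  exists [set x : config A | x 0 = c]; last by rewrite setTI.
  exact: (coord_measurable 0 [set c]).
have tr k c : exists B : set path_space, [/\ measurable B,
    mu.-negligible ([set x | (iter k (@tau A) x : config A) 0 = c] `+`
      joint X @^-1` B) &
    Sigma P [set m | (k <= m)%N] X' (joint X' @^-1` B)].
  by apply: transfer_Sigma; rewrite -(gen k); exact: sym.
have {tr} [B hB] : exists B : nat -> A -> set path_space, forall k c,
   [/\ measurable (B k c),
    mu.-negligible ([set x | (iter k (@tau A) x : config A) 0 = c] `+`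
      joint X @^-1` B k c) &
    Sigma P [set m | (k <= m)%N] X' (joint X' @^-1` B k c)].
  exists (fun k c => sval (cid (tr k c))) => k c.
  exact: svalP (cid (tr k c)).
pose phi (i : nat) (y : path_space) : A := letter_of (B 0%N) (iter i shift_path y).
have msh i : measurable_fun setT (iter i shift_path).
  elim: i => [|i IH]; first exact: measurable_id.
  exact: (measurableT_comp shift_path_measurable IH).
have mphi : adapted measurable phi.
  move=> i a.
  have m0 : measurable (letter_of (B 0%N) @^-1` [set a]).
    apply: letter_of_sigma; first exact: sigma_algebra_measurable.
    by move=> b; case: (hB 0%N b).
  by have := msh i measurableT _ m0; rewrite setTI.
have ae0 : mu.-negligible [set x | phi 0%N (joint X x) <> x 0].
  have nU : mu.-negligible (\bigcup_(a : A)
      ([set x : config A | x 0 = a] `+` joint X @^-1` B 0%N a)).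
    by apply: negligible_fin => a; case: (hB 0%N a).
  apply: negligibleS nU.
  move=> x; apply: contra_notP => nx; apply: letter_of_eq => a.
  split=> [Ba|xa].
    apply: contrapT => xa; apply: nx; exists a => //; right; split=> //.
  by apply: contrapT => Ba; apply: nx; exists a => //; left.
have mT i : measurable_fun setT (iter i (left_shift A)).
  elim: i => [|i IH]; first exact: measurable_id.
  exact: (measurableT_comp (@left_shift_measurable A) IH).
have pT i D : measurable D -> mu (iter i (left_shift A) @^-1` D) = mu D.
  elim: i D => // i IH D mD.
  rewrite -[RHS](left_shift_preserves hmu mD).
  rewrite -(IH (left_shift A @^-1` D))//.
  by have := left_shift_measurable measurableT mD; rewrite setTI.
have itE i (x : config A) j : iter i (left_shift A) x j = x (j + i%:Z).
  elim: i j => [|i IH] j; first by rewrite addr0.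
  rewrite iterS [LHS]/= /lshift_fun IH.
  by congr x; lia.
(* Off the null set N the coordinates are read from the paths without error. *)
pose N := \bigcup_i [set x : config A | phi i (joint X x) <> x i%:Z].
have nN : mu.-negligible N.
  apply: negligible_bigcup => i.
  apply: negligibleS (negligible_preimage (mT i) (pT i) ae0) => x /=.
  by rewrite joint_shift itE add0r.
have aeN x : ~ N x -> forall i, phi i (joint X x) = x i%:Z.
  by move=> nx i; apply: contrapT => h; apply: nx; exists i.
have transport (D : set path_space) (F : set (config A)) :
    (forall x, ~ N x -> D (joint X x) <-> F x) ->
    mu.-negligible (F `+` joint X @^-1` D).
  move=> DF; apply: negligibleS nN => x; apply: contraPP => /DF h.
  by case=> -[] h1 h2; apply: h2; apply/h.
pose x i w := phi i (joint X' w).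
have tauE k (y : config A) : (iter k (@tau A) y : config A) 0 =
    iter k tau_process (fun i (_ : unit) => y i%:Z : A) 0%N tt.
  have h i : (iter k (@tau A) y : config A) i%:Z =
    iter k tau_process (fun i (_ : unit) => y i%:Z : A) i tt.
    elim: k i => // k IH i; rewrite !iterS /tau_process -!IH.
    by rewrite /tau (_ : i%:Z + 1 = i.+1%:Z)//; lia.
  exact: h 0%N.
exists x; split.
- by move=> i w; rewrite /x joint_shift'.
- move=> i a.
  by apply: (joint_measurable (Y := X') (B := phi i @^-1` [set a])).
- move=> M b.
  have mcyl : measurable (cylinder phi M b).
    by apply: cylinder_sigma => //; exact: sigma_algebra_measurable.
  rewrite -(uniform_cylinder hmu M b).
  transitivity (mu (joint X @^-1` cylinder phi M b)).
    by symmetry; exact: law.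
  symmetry; apply: pr_ae_eq.
  + apply: (@cylinder_sigma A (config A) measurable
      (fun i (y : config A) => y i%:Z)).
      exact: sigma_algebra_measurable.
    by move=> i a; exact: (coord_measurable i%:Z [set a]).
  + exact: joint_measurable.
  + apply: transport => y /aeN h /=.
    by split=> h' i /h'; rewrite h.
- move=> k c; have [mB nB sB] := hB k c.
  exists (joint X' @^-1` B k c) => //.
  pose D := iter k tau_process phi 0%N @^-1` [set c].
  have mD : measurable D.
    apply: adapted_tau => //; exact: sigma_algebra_measurable.
  have -> : iter k tau_process x 0%N @^-1` [set c] = joint X' @^-1` D.
    apply/seteqP; split=> w /=; rewrite (@eq_tau_process _ _ _ x phi k 0 w (joint X' w))//.
  have -> : joint X' @^-1` B k c `+` joint X' @^-1` D =
    joint X' @^-1` (B k c `+` D) by [].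
  have mBD : measurable (B k c `+` D) by apply: measurableU; exact: measurableD.
  apply: (transfer_negligible mX mX' law mBD).
  pose F := [set y | (iter k (@tau A) y : config A) 0 = c].
  have nD : mu.-negligible (F `+` joint X @^-1` D).
    apply: transport => y /aeN h; rewrite /F /D /= tauE.
    rewrite (@eq_tau_process _ _ _ phi (fun i (_ : unit) => y i%:Z : A) k 0 _ tt)//.
  apply: negligibleS (negligibleU nB nD) => y /=.
  by have [|] := pselect (F y); rewrite /F/=; tauto.
Qed.

End copy.

(** * Non-standardness *)

Theorem theorem3p11 (R : realType) (A : finZmodType) (hA : (2 <= #|A|)%N)
    (mu : probability (config A) R) (hmu : uniform_product_measure mu) :
  ~ dynamically_standard mu (left_shift A) (tau_filtration mu).
Proof.
move=> [d' [Om [P [S [G [[dynS filtG facG] [H [facH indH GH]]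
  [F' [facF' [dE [E [X [X' [_ [gen gen'] SX SX' law]]]]] [F'G _]]]]]]]]].
have [x [xS mx ux xF]] := transferred_process hmu SX SX' law gen.
pose Q : probability (completion P) R := completed_probability P.
have [_ mS _ PS] := dynS.
have sG k : sigma_algebra setT (G k) by case: (facG k) => -[].
have mG k : G k `<=` (measurable : set (set (completion P))).
  by case: (facG k) => -[].
have sH k : sigma_algebra setT (H k) by case: (facH k) => -[].
have mH k : H k `<=` (measurable : set (set (completion P))).
  by case: (facH k) => -[].
have SG k i a : G k a -> G k (iter i S @^-1` a).
  elim: i a => // i IH a Ga.
  have -> : iter i.+1 S @^-1` a = iter i S @^-1` (S @^-1` a) by [].
  by apply: IH; case: (facG k) => _ /(_ _ Ga) [].
(* [G] contains the null sets and the image of the filtration of [mu], hence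
   the k-th iterate of the process is measurable for [G k]. *)
pose y k := iter k tau_process x.
have Gy0 k c : G k (y k 0%N @^-1` [set c]).
  have [B FB nB] := xF k c.
  apply: sigma_ae_eq (sG k) _ _ nB; first by case: (facG k) => -[].
  by apply: F'G; rewrite gen'.
have Gy k : adapted (G k) (y k).
  move=> i c; have -> : y k i @^-1` [set c] = iter i S @^-1` (y k 0%N @^-1` [set c]).
    by apply/seteqP; split=> w /=; rewrite /y (tau_process_shift k i w xS).
  exact/SG/Gy0.
(* In the encoding of times by absolute values, [recent n] is generated by the
   factors at the n most recent times; it is independent of [G n]. *)
pose recent n := <<s \bigcup_(m in [set m | (m < n)%N]) H m >>.
have sQ n : sigma_algebra setT (recent n) by exact: smallest_sigma_algebra.
have mQ n : recent n `<=` (measurable : set (set (completion P))).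
  apply: smallest_sub; first exact: sigma_algebra_measurable.
  by move=> E' [m _]; exact: mH.
have homoQ n n' : (n <= n')%N -> recent n `<=` recent n'.
  move=> nn'; apply: smallest_sub; first exact: smallest_sigma_algebra.
  move=> E' [m /= mn HE]; apply: sub_sigma_algebra; exists m => //=.
  exact: leq_trans nn'.
have SQ n i a : recent n a -> recent n (iter i S @^-1` a).
  elim: i a => // i IH a Ga.
  have -> : iter i.+1 S @^-1` a = iter i S @^-1` (S @^-1` a) by [].
  apply: IH; apply: (sigma_preimage (sQ n) _ Ga) => b [m mn Hb].
  apply: sub_sigma_algebra; exists m => //.
  by case: (facH m) => _ /(_ _ Hb) [].
(* One error [e] for each of the letters adds up to 1/4. *)
pose e : R := (4 * #|A|%:R)^-1.
have A0 : 0 < #|A|%:R :> R by rewrite ltr0n; exact: leq_trans hA.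
have e0 : 0 < e by rewrite invr_gt0 mulr_gt0.
have appr a : exists nD : nat * set Om, recent nD.1 nD.2 /\
    fine (Q ((x 0%N @^-1` [set a]) `+` nD.2)) <= e.
  have [n [D [hD le]]] : exists n D, recent n D /\
      fine (Q ((x 0%N @^-1` [set a]) `+` D)) <= e.
    pose F := x 0%N @^-1` [set a] : set (completion P).
    suff Fs : <<s \bigcup_k recent k >> F.
      exact: (@increasing_approximation R _ (completion P) Q recent F sQ mQ homoQ Fs e e0).
    have : G 0%N F by exact: Gy0.
    rewrite GH; move: F; apply: smallest_sub; first exact: smallest_sigma_algebra.
    move=> E' [m _ HE]; apply: sub_sigma_algebra; exists m.+1 => //.
    by apply: sub_sigma_algebra; exists m => /=.
  by exists (n, D).
move/choice: appr => [nD hD].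
pose n := (\max_a (nD a).1)%N.
pose D a := (nD a).2.
have QD a : recent n (D a).
  by have [h _] := hD a; apply: homoQ h; exact: leq_bigmax.
pose V i w := letter_of (D : A -> set (completion P)) (iter i S w).
have V0 a : recent n (V 0%N @^-1` [set a]) by exact: letter_of_sigma.
have QV : adapted (recent n) V.
  move=> i c; exact: (SQ n i _ (V0 c)).
have mV : adapted (measurable : set (set (completion P))) V.
  by move=> i c; exact: (mQ n _ (QV i c)).
have mxc : adapted (measurable : set (set (completion P))) x.
  by move=> i c; exact: (measurable_completion P (mx i c)).
have mne i : measurable ([set w | x i w <> V i w] : set (completion P)).
  have mZ : adapted (measurable : set (set (completion P)))
      (fun i w => x i w - V i w).
    apply: (@adapted_comb A (completion P) (fun a b => a - b)) => //.
    exact: sigma_algebra_measurable.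
  rewrite [X in measurable X](_ : _ = ~` ((fun w => x i w - V i w) @^-1` [set 0])).
    by apply: measurableC; exact: (mZ i 0).
  apply/seteqP; split=> w /=; apply: contra_not => /eqP.
    by rewrite subr_eq0 => /eqP.
  by move=> /eqP h; apply/eqP; rewrite subr_eq0; apply/eqP.
apply: (@no_approximation R A _ (completion P) Q x V n hA mxc mV).
- move=> N b.
  have mc : measurable (cylinder x N b).
    apply: cylinder_sigma => //; exact: sigma_algebra_measurable.
  by rewrite [Q _](completed_probabilityE P mc) ux.
- move=> N b c.
  have mb : recent n (cylinder (iter n tau_process V) N b).
    by apply: (@cylinder_sigma A (completion P)) => //; exact: adapted_tau.
  have mc : G n (cylinder (iter n tau_process x) N c).
    by apply: (@cylinder_sigma A (completion P)) => //; exact: Gy.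
  rewrite (@independent_blocks R _ (completion P) Q H n sH mH indH)//.
    rewrite fineM//; apply: fin_num_measure; [exact: (mQ n)|exact: (mG n)].
  by rewrite -GH.
- have close0 : fine (Q [set w | x 0%N w <> V 0%N w]) <= 4^-1.
    apply: (@le_trans _ _ (\sum_(a : A) e)).
      apply: (@le_trans _ _ (\sum_a fine (Q ((x 0%N @^-1` [set a]) `+` D a)))).
        apply: pr_union => //.
          move=> a; apply: measurableU; apply: measurableD => //;
            exact: (mQ n _ (QD a)).
        move=> w; apply: contra_notP => nw.
        symmetry; apply: letter_of_eq => a; split=> h; apply: contrapT => h'.
          by apply: nw; exists a => //; right.
        by apply: nw; exists a => //; left.
      by apply: ler_sum => a _; case: (hD a).
    by rewrite sumr_const -[e *+ _]mulr_natl /e invfM mulrCA divff ?mulr1// gt_eqF.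
  have mSi i : measurable_fun setT (iter i S).
    elim: i => [|i IH]; first exact: measurable_id.
    exact: (measurableT_comp mS IH).
  have PSi i B : measurable B -> P (iter i S @^-1` B) = P B.
    elim: i B => // i IH B mB.
    rewrite -[RHS](PS _ mB) -(IH (S @^-1` B))//.
    by have := mS measurableT _ mB; rewrite setTI.
  move=> i; apply: le_trans close0.
  have E1 : [set w | x i w <> V i w] = iter i S @^-1` [set w | x 0%N w <> V 0%N w].
    by apply/seteqP; split=> w /=; rewrite (xS i w).
  rewrite -lee_fin -!prE//.
  by rewrite E1; exact: (mu_ext_preimage _ (mSi i) (PSi i)).
Qed.
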